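(* Let $G$ be a cograph. Then $G$ admits an $(s,1)$-polar partition for some integer $s \ge 2$ if and only if $G$ does not contain any of the graphs $K_1 + 2K_2$, $\overline{K_2} + C_4$, $2P_3$, $K_1 + (\overline{P_3} \oplus \overline{K_2})$ as an induced subgraph.
   Context: All graphs are finite and simple. A cograph is a graph with no induced path $P_4$ on four vertices. $G+H$ denotes disjoint union, $nG$ the disjoint union of $n$ copies of $G$, $G \oplus H$ the join (disjoint union plus all edges between $G$ and $H$), and $\overline{G}$ the complement. $P_k$ and $C_k$ are the path and cycle on $k$ vertices. An $(s,1)$-polar partition of $G$ is a partition $(A,B)$ of $V(G)$ (parts may be empty) such that $A$ induces a complete multipartite graph with at most $s$ parts, and $B$ is a clique. *)

(* Defs.v *)
From mathcomp Require Import all_boot.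

Set Implicit Arguments.
Unset Strict Implicit.
Unset Printing Implicit Defensive.

Record sgraph := SGraph {
  vertex :> finType;
  edge : rel vertex;
  edge_sym : symmetric edge;
  edge_irrefl : irreflexive edge }.

(* [H] embeds in [G] as an induced subgraph, i.e., [H] is isomorphic to the
   subgraph of [G] induced by the image of [f]. *)
Definition induced_subgraph (H G : sgraph) : Prop :=
  exists f : H -> G,
    injective f /\ (forall x y : H, edge (f x) (f y) = edge x y).

Definition path_rel (k : nat) : rel 'I_k :=
  fun i j => (i.+1 == j :> nat) || (j.+1 == i :> nat).

Lemma path_rel_sym k : symmetric (@path_rel k).
Proof. by move=> i j; rewrite /path_rel orbC. Qed.

Lemma path_rel_irrefl k : irreflexive (@path_rel k).
Proof. by move=> i; rewrite /path_rel orbb gtn_eqF. Qed.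

Definition path_graph (k : nat) : sgraph :=
  SGraph (@path_rel_sym k) (@path_rel_irrefl k).

(* This is the cycle C_k for k >= 3 only; the test [i != j] is redundant in
   that range and excludes a loop when k = 1. *)
Definition cycle_rel (k : nat) : rel 'I_k :=
  fun i j => (i != j) && ((i.+1 %% k == j) || (j.+1 %% k == i)).

Lemma cycle_rel_sym k : symmetric (@cycle_rel k).
Proof. by move=> i j; rewrite /cycle_rel eq_sym orbC. Qed.

Lemma cycle_rel_irrefl k : irreflexive (@cycle_rel k).
Proof. by move=> i; rewrite /cycle_rel eqxx. Qed.

Definition cycle_graph (k : nat) : sgraph :=
  SGraph (@cycle_rel_sym k) (@cycle_rel_irrefl k).

Definition complete_rel (n : nat) : rel 'I_n := fun i j => i != j.

Lemma complete_rel_sym n : symmetric (@complete_rel n).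
Proof. by move=> i j; rewrite /complete_rel eq_sym. Qed.

Lemma complete_rel_irrefl n : irreflexive (@complete_rel n).
Proof. by move=> i; rewrite /complete_rel eqxx. Qed.

Definition complete_graph (n : nat) : sgraph :=
  SGraph (@complete_rel_sym n) (@complete_rel_irrefl n).

Definition compl_rel (G : sgraph) : rel G := fun x y => (x != y) && ~~ edge x y.

Lemma compl_rel_sym G : symmetric (@compl_rel G).
Proof. by move=> x y; rewrite /compl_rel eq_sym edge_sym. Qed.

Lemma compl_rel_irrefl G : irreflexive (@compl_rel G).
Proof. by move=> x; rewrite /compl_rel eqxx. Qed.

Definition compl_graph (G : sgraph) : sgraph :=
  SGraph (@compl_rel_sym G) (@compl_rel_irrefl G).

(* [b] tells whether vertices on different sides are adjacent. *)
Definition sum_rel (b : bool) (G H : sgraph) : rel (G + H)%type :=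
  fun u v => match u, v with
             | inl x, inl y => edge x y
             | inr x, inr y => edge x y
             | _, _ => b
             end.

Lemma sum_rel_sym b G H : symmetric (@sum_rel b G H).
Proof. by move=> [x|x] [y|y] //=; rewrite edge_sym. Qed.

Lemma sum_rel_irrefl b G H : irreflexive (@sum_rel b G H).
Proof. by move=> [x|x] /=; rewrite edge_irrefl. Qed.

Definition disjoint_union (G H : sgraph) : sgraph :=
  SGraph (@sum_rel_sym false G H) (@sum_rel_irrefl false G H).

Definition join_graph (G H : sgraph) : sgraph :=
  SGraph (@sum_rel_sym true G H) (@sum_rel_irrefl true G H).

Definition copies_rel (n : nat) (G : sgraph) : rel ('I_n * G)%type :=
  fun u v => (u.1 == v.1) && edge u.2 v.2.

Lemma copies_rel_sym n G : symmetric (@copies_rel n G).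
Proof. by move=> u v; rewrite /copies_rel eq_sym edge_sym. Qed.

Lemma copies_rel_irrefl n G : irreflexive (@copies_rel n G).
Proof. by move=> u; rewrite /copies_rel edge_irrefl andbF. Qed.

Definition copies (n : nat) (G : sgraph) : sgraph :=
  SGraph (@copies_rel_sym n G) (@copies_rel_irrefl n G).

Definition cograph (G : sgraph) : Prop := ~ induced_subgraph (path_graph 4) G.

Definition is_clique (G : sgraph) (B : {set G}) : Prop :=
  {in B &, forall x y, x != y -> edge x y}.

(* The blocks of a [partition] are nonempty, so the empty set is complete
   multipartite with 0 parts, and a nonempty independent set with 1 part. *)
Definition induces_complete_multipartite (G : sgraph) (s : nat) (A : {set G}) :
    Prop :=
  exists P : {set {set G}},
    [/\ partition P A, #|P| <= s &
        {in A &, forall x y,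
          edge x y = ~~ [exists p in P, (x \in p) && (y \in p)]}].

(* [partition] is not used for (A, B) because A or B may be empty. *)
Definition polar_partition (G : sgraph) (s : nat) (A B : {set G}) : Prop :=
  [/\ A :|: B = [set: G], A :&: B = set0,
      induces_complete_multipartite s A & is_clique B].

(* Main.v *)
Require Import Defs.
From mathcomp Require Import all_boot.

Set Implicit Arguments.
Unset Strict Implicit.
Unset Printing Implicit Defensive.

(** In a cograph, every vertex set with at least two elements splits into two
    nonempty parts with either all or no edges between them. Complete
    multipartite means free of [K_1 + K_2], so joining two polar pieces merges
    their multipartite sides and their cliques. If instead there are no edges
    between the parts [X] and [Y] and both contain an edge, then both are
    complete multipartite by [K_1 + 2K_2] and one of them is a clique by [2P_3].
    If [X] is edgeless, then [X :|: Y] is [2K_2]-free; either it is [C_4]-free,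
    hence split, or [X] is a single vertex and [Y] is complete multipartite. *)

(** * Decomposition of cographs by complete and anticomplete separations *)

Definition P4_free (G : sgraph) : Prop :=
  forall a b c d : G, edge a b -> edge b c -> edge c d ->
    ~~ edge a c -> ~~ edge a d -> ~~ edge b d -> False.

Definition anticomplete (G : sgraph) (X Y : {set G}) : Prop :=
  {in X & Y, forall x y, ~~ edge x y}.

Definition complete_to (G : sgraph) (X Y : {set G}) : Prop :=
  {in X & Y, forall x y, edge x y}.

Definition separation (G : sgraph) (U X Y : {set G}) : Prop :=
  [/\ X != set0, Y != set0, X :|: Y = U & [disjoint X & Y]].

Lemma separation_sym (G : sgraph) (U X Y : {set G}) :
  separation U X Y -> separation U Y X.
Proof. by case=> ? ? ? ?; split; rewrite 1?setUC 1?disjoint_sym. Qed.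

Lemma anticomplete_sym (G : sgraph) (X Y : {set G}) :
  anticomplete X Y -> anticomplete Y X.
Proof. by move=> h x y xY yX; rewrite edge_sym h. Qed.

Lemma complete_to_sym (G : sgraph) (X Y : {set G}) :
  complete_to X Y -> complete_to Y X.
Proof. by move=> h x y xY yX; rewrite edge_sym h. Qed.

Lemma anticomplete_compl (G : sgraph) (X Y : {set G}) :
  [disjoint X & Y] ->
  anticomplete (G := compl_graph G) X Y <-> complete_to (G := G) X Y.
Proof.
move=> dXY; split=> h x y xX yY; have := h x y xX yY; rewrite /= /compl_rel;
  have -> /= : x != y by apply: contraTneq xX => ->; rewrite (disjointFl dXY yY).
  by rewrite negbK.
by move=> ->.
Qed.

Lemma complete_to_compl (G : sgraph) (X Y : {set G}) :
  complete_to (G := compl_graph G) X Y -> anticomplete (G := G) X Y.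
Proof. by move=> h x y xX yY; case/andP: (h x y xX yY). Qed.

(** The path on four vertices is self-complementary: a path [a b c d] in the complement is the path
    [b d a c] in [G]. *)
Lemma P4_free_compl (G : sgraph) : P4_free G -> P4_free (compl_graph G).
Proof.
move=> h4 a b c d; rewrite /= /compl_rel => /andP[ab nab] /andP[bc nbc].
move=> /andP[cd ncd]; rewrite !negb_and !negbK.
case: (eqVneq a c) => [ac|_ /= ac]; first by rewrite ac (negPf cd) (negPf ncd).
case: (eqVneq a d) => [ad|_ /= ad].
  by rewrite ad edge_sym (negPf ncd) in ac.
case: (eqVneq b d) => [bd|_ /= bd]; first by rewrite -bd (negPf nab) in ad.
by apply: (h4 b d a c) => //; rewrite 1?edge_sym.
Qed.

(** This is the inductive step for inserting a vertex. Only an anticomplete separation is treated;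
    the complete one is reached by passing to the complement. *)
Lemma separation_add (G : sgraph) (v : G) (U X Y : {set G}) :
  P4_free G -> v \notin U -> separation U X Y -> anticomplete X Y ->
  exists X' Y', separation (v |: U) X' Y' /\
    (anticomplete X' Y' \/ complete_to X' Y').
Proof.
move=> h4 vU sUXY aXY.
have [/forall_inP vall|] := boolP [forall w in U, edge v w].
  exists [set v], U; split; last by right=> x y /set1P-> /vall.
  case: sUXY => X0 _ UE _; split=> //; last by rewrite disjoints1.
    by apply/set0Pn; exists v; rewrite set11.
  by apply: subset_neq0 X0; rewrite -UE subsetUl.
rewrite negb_forall_in => /exists_inP[w wU vw].
wlog wX : X Y sUXY aXY / w \in X.
  move=> wl; have /setUP[] : w \in X :|: Y by case: sUXY => _ _ ->.
    exact: wl sUXY aXY.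
  exact: wl (separation_sym sUXY) (anticomplete_sym aXY).
case: (sUXY) => X0 Y0 UE dXY.
have vX : v \notin X by apply: contra vU => vX; rewrite -UE inE vX.
have vY : v \notin Y by apply: contra vU => vY; rewrite -UE inE vY orbT.
(* Either the non-neighbours X1 of v in X form a part of their own, or an edge
   ab leaving X1 forces v to miss Y, as a neighbour c of v in Y would complete
   the induced path b a v c. *)
pose X1 := [set x in X | ~~ edge v x].
have wX1 : w \in X1 by rewrite inE wX.
have sX1U : X1 \subset U.
  by apply/subsetP=> x; rewrite -UE !inE => /andP[->].
have [/exists_inP[b bX1 /exists_inP[a aX /andP[va ab]]]|nX1] :=
  boolP [exists b in X1, exists a in X, edge v a && edge a b].
  have [bX vb] : b \in X /\ ~~ edge v b by move: bX1; rewrite inE => /andP.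
  exists Y, (v |: X); split.
    split=> //; first by apply/set0Pn; exists v; rewrite setU11.
      by rewrite setUCA (setUC Y) UE.
    rewrite -setI_eq0 setIUr setU_eq0 !setI_eq0 (disjoint_sym Y X) dXY andbT.
    by rewrite disjoint_sym disjoints1.
  left=> c x cY /setU1P[->|xX]; last by rewrite edge_sym aXY.
  apply/negP=> vc; apply: (h4 b a v c) => //; first [exact: aXY | by rewrite edge_sym].
exists X1, (v |: U :\: X1); split.
  split.
  - by apply/set0Pn; exists w.
  - by apply/set0Pn; exists v; rewrite setU11.
  - by rewrite setUCA -[in RHS](setID U X1) (setIidPr sX1U).
  - apply/pred0P=> z /=; rewrite !inE; case: eqVneq => [->|_] /=.
      by rewrite (negPf vX).
    by case: (z \in X) (edge v z) => [] [].
(* [X1] misses [v] by its definition, [Y] because [X] does, and the neighbours of [v] in [X] by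
   [nX1]. *)
left=> x z xX1; have /andP[xX vx] : (x \in X) && ~~ edge v x by rewrite inE in xX1.
case/setU1P=> [->|]; first by rewrite edge_sym.
rewrite -UE 3!inE => /andP[zX1 /orP[zX|]]; last exact: aXY.
rewrite zX /= negbK in zX1; apply: contra nX1 => xz.
apply/exists_inP; exists x => //; apply/exists_inP; exists z => //.
by rewrite zX1 edge_sym.
Qed.

(** Induction on the size of [U], deleting one vertex: this is the classical fact that a cograph or
    its complement is disconnected. *)
Lemma cograph_separation (G : sgraph) (U : {set G}) :
  P4_free G -> 1 < #|U| ->
  exists X Y, separation U X Y /\ (anticomplete X Y \/ complete_to X Y).
Proof.
move=> h4; have [n] := ubnP #|U|; elim: n U => // n IHn U; rewrite ltnS => Un U1.
have /card_gt0P[v vU] : 0 < #|U| by apply: ltnW.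
have vU' : v \notin U :\ v by rewrite setD11.
have cU := cardsD1 v U; rewrite vU add1n in cU.
have [U'1|U'1] := ltnP 1 #|U :\ v|.
  have Un' : #|U :\ v| < n by rewrite -cU.
  have [X [Y [sXY [aXY|cXY]]]] := IHn _ Un' U'1.
    by have := separation_add h4 vU' sXY aXY; rewrite setD1K.
  (* In the complement, again [P4_free], the complete separation is anticomplete; the separation
     obtained there is translated back. *)
  have aXY : anticomplete (G := compl_graph G) X Y.
    by apply/anticomplete_compl => //; case: sXY.
  have [X' [Y']] := separation_add (P4_free_compl h4) vU' sXY aXY.
  rewrite setD1K // => -[sXY' h]; exists X', Y'; split=> //.
  case: h => [/anticomplete_compl|/complete_to_compl] h; last by left.
  by right; apply: h; case: sXY'.
have /cards1P[w Uw] : #|U :\ v| == 1 by rewrite eqn_leq U'1 -ltnS -cU.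
exists [set v], [set w]; split.
  split; rewrite -?Uw ?setD1K ?disjoints1 //.
    by apply/set0Pn; exists v; rewrite set11.
  by rewrite Uw; apply/set0Pn; exists w; rewrite set11.
case: (boolP (edge v w)) => vw; [right|left];
  by move=> x y /set1P-> /set1P->.
Qed.

(** Induction along the cotree, phrased on vertex sets so that no tree has to be built. *)
Lemma cograph_ind (G : sgraph) (P : {set G} -> Prop) :
  P4_free G -> 
  (forall U : {set G}, #|U| <= 1 -> P U) ->
  (forall X Y : {set G}, X != set0 -> Y != set0 -> [disjoint X & Y] ->
     anticomplete X Y ->
     P X -> P Y -> P (X :|: Y)) ->
  (forall X Y : {set G}, complete_to X Y -> P X -> P Y -> P (X :|: Y)) ->
  forall U, P U.
Proof.
move=> h4 P1 Pa Pc U; have [n] := ubnP #|U|; elim: n U => // n IHn U.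
rewrite ltnS => Un; have [/P1//|U1] := leqP #|U| 1.
have [X [Y [[X0 Y0 UE dXY] h]]] := cograph_separation h4 U1.
move: X0 Y0 Un; rewrite -UE -!card_gt0 cardsU (disjoint_setI0 dXY) cards0 subn0.
move=> X0 Y0 XYn.
have PX : P X by apply: IHn; apply: leq_trans XYn; rewrite -addn1 leq_add2l.
have PY : P Y by apply: IHn; apply: leq_trans XYn; rewrite -add1n leq_add2r.
by rewrite !card_gt0 in X0 Y0; case: h => h; [apply: Pa | apply: Pc].
Qed.

(** * Multipartite sets, small induced patterns and split partitions *)

Definition independent (G : sgraph) (A : {set G}) : Prop :=
  {in A &, forall x y, ~~ edge x y}.

(** In contrapositive form, non-adjacency is transitive on [A]. The number of parts is recovered
    only at the end. *)
Definition multipartite (G : sgraph) (A : {set G}) : Prop :=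
  {in A & &, forall x y z, edge y z -> edge x y || edge x z}.

(** The ends of the path must be distinct by fiat, as must opposite vertices in [is_C4]; in [is_2K2]
    the adjacencies already separate all four vertices. *)
Definition is_P3 (G : sgraph) (a b c : G) : bool :=
  [&& a != c, edge a b, edge b c & ~~ edge a c].

Definition is_2K2 (G : sgraph) (a b c d : G) : bool :=
  [&& edge a b, edge c d, ~~ edge a c, ~~ edge a d, ~~ edge b c & ~~ edge b d].

Definition is_C4 (G : sgraph) (a b c d : G) : bool :=
  [&& a != c, b != d, edge a b, edge b c, edge c d, edge d a,
      ~~ edge a c & ~~ edge b d].

Definition free_2K2 (G : sgraph) (U : {set G}) : Prop :=
  forall a b c d, {subset [:: a; b; c; d] <= U} -> ~~ is_2K2 a b c d.

Definition free_C4 (G : sgraph) (U : {set G}) : Prop :=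
  forall a b c d, {subset [:: a; b; c; d] <= U} -> ~~ is_C4 a b c d.

Lemma subset4P (T : finType) (U : {set T}) (a b c d : T) :
  {subset [:: a; b; c; d] <= U} <-> [/\ a \in U, b \in U, c \in U & d \in U].
Proof.
split=> [h|[aU bU cU dU] x]; first by split; apply: h; rewrite !inE eqxx ?orbT.
by rewrite !inE => /or4P[] /eqP->.
Qed.

Lemma free_2K2_sub (G : sgraph) (U V : {set G}) :
  U \subset V -> free_2K2 V -> free_2K2 U.
Proof. by move=> /subsetP sUV h a b c d hU; apply: h => x /hU/sUV. Qed.

Lemma free_C4_sub (G : sgraph) (U V : {set G}) :
  U \subset V -> free_C4 V -> free_C4 U.
Proof. by move=> /subsetP sUV h a b c d hU; apply: h => x /hU/sUV. Qed.

(** This dichotomy and the three after it are constructive: each tests a boolean existential over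
    tuples of a finite type. *)
Lemma cliqueVnonedge (G : sgraph) (X : {set G}) :
  is_clique X \/ exists a c, [/\ a \in X, c \in X, a != c & ~~ edge a c].
Proof.
have [/existsP[[a c] /and4P[]]|/existsPn nX] :=
  boolP [exists p : G * G,
    [&& p.1 \in X, p.2 \in X, p.1 != p.2 & ~~ edge p.1 p.2]].
  by right; exists a, c.
by left=> a c aX cX ac; have := nX (a, c); rewrite /= aX cX ac negbK.
Qed.

Lemma independentVedge (G : sgraph) (X : {set G}) :
  independent X \/ exists a c, [/\ a \in X, c \in X & edge a c].
Proof.
have [/existsP[[a c] /and3P[]]|/existsPn nX] :=
  boolP [exists p : G * G, [&& p.1 \in X, p.2 \in X & edge p.1 p.2]].
  by right; exists a, c.
by left=> a c aX cX; have := nX (a, c); rewrite /= aX cX.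
Qed.

Lemma multipartiteVcoP3 (G : sgraph) (X : {set G}) :
  multipartite X \/
  exists x y z, [/\ x \in X, y \in X & z \in X] /\
    [/\ edge y z, ~~ edge x y & ~~ edge x z].
Proof.
have [/existsP[[[x y] z] /and4P[/= ? ? ? /and3P[]]]|/existsPn nX] :=
  boolP [exists p : G * G * G,
    [&& p.1.1 \in X, p.1.2 \in X, p.2 \in X &
        [&& edge p.1.2 p.2, ~~ edge p.1.1 p.1.2 & ~~ edge p.1.1 p.2]]].
  by right; exists x, y, z.
left=> x y z xX yX zX yz; have := nX (x, y, z).
by rewrite /= xX yX zX yz -negb_or negbK.
Qed.

Lemma free_C4VC4 (G : sgraph) (X : {set G}) :
  free_C4 X \/
  exists a b c d, {subset [:: a; b; c; d] <= X} /\ is_C4 a b c d.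
Proof.
have [/existsP[[[[a b] c] d] /andP[/allP ? ?]]|/existsPn nX] :=
  boolP [exists p : G * G * G * G,
    all (mem X) [:: p.1.1.1; p.1.1.2; p.1.2; p.2] &&
    is_C4 p.1.1.1 p.1.1.2 p.1.2 p.2].
  by right; exists a, b, c, d.
by left=> a b c d /allP hX; have := nX (a, b, c, d); rewrite hX.
Qed.

(** Two non-adjacent vertices [a], [c] lie in the same part. The edge [p q] meets some other part,
    which yields a neighbour [b] of [a], hence also of [c]. *)
Lemma multipartite_clique_or_P3 (G : sgraph) (X : {set G}) (p q : G) :
  p \in X -> q \in X -> edge p q -> multipartite X ->
  is_clique X \/
  exists a b c, [/\ a \in X, b \in X & c \in X] /\ is_P3 a b c.
Proof.
move=> pX qX pq mX; have [|[a [c [aX cX ac nac]]]] := cliqueVnonedge X.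
  by left.
have [b bX ab] : exists2 b, b \in X & edge a b.
  by case/orP: (mX a p q aX pX qX pq); [exists p | exists q].
right; exists a, b, c; split=> //; rewrite /is_P3 ac ab nac andbT edge_sym.
by have := mX c a b cX aX bX ab; rewrite edge_sym (negPf nac).
Qed.

Lemma multipartite_card1 (G : sgraph) (U : {set G}) :
  #|U| <= 1 -> multipartite U.
Proof.
by move=> /card_le1_eqP U1 x y z _ yU zU; rewrite (U1 y z) // edge_irrefl.
Qed.

Lemma independent_multipartite (G : sgraph) (U : {set G}) :
  independent U -> multipartite U.
Proof. by move=> iU x y z _ yU zU; rewrite (negPf (iU _ _ yU zU)). Qed.

(** A four-cycle is connected, so it stays on the side of its first vertex. *)
Lemma free_C4_anticomplete (G : sgraph) (X Y : {set G}) :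
  anticomplete X Y -> free_C4 X -> free_C4 Y -> free_C4 (X :|: Y).
Proof.
move=> aXY fX fY a b c d /subset4P[aU bU cU dU]; apply/negP=> C4.
have /and5P[_ _ ab bc /and4P[cd da _ _]] := C4.
have aYX := anticomplete_sym aXY.
have pX x y : edge x y -> x \in X -> y \in X :|: Y -> y \in X.
  by move=> xy xX; case/setUP=> // yY; rewrite (negPf (aXY _ _ xX yY)) in xy.
have pY x y : edge x y -> x \in Y -> y \in X :|: Y -> y \in Y.
  by move=> xy xX; case/setUP=> // yY; rewrite (negPf (aYX _ _ xX yY)) in xy.
case/setUP: (aU) => aXoY.
  have bX := pX _ _ ab aXoY bU; have cX := pX _ _ bc bX cU.
  by have /subset4P/fX/negP[] := And4 aXoY bX cX (pX _ _ cd cX dU).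
have bX := pY _ _ ab aXoY bU; have cX := pY _ _ bc bX cU.
by have /subset4P/fY/negP[] := And4 aXoY bX cX (pY _ _ cd cX dU).
Qed.

Lemma nonedge_complete_to (G : sgraph) (X Y : {set G}) (a b : G) :
  complete_to X Y -> a \in X :|: Y -> b \in X :|: Y -> ~~ edge a b ->
  a \in X /\ b \in X \/ a \in Y /\ b \in Y.
Proof.
move=> cXY; have cYX := complete_to_sym cXY.
case/setUP=> aX /setUP[] bX nab; [by left | | | by right].
  by rewrite cXY in nab.
by rewrite cYX in nab.
Qed.

(** The forbidden subgraph characterization of split graphs, where [C_5] is excluded by its induced
    [P_4]. Across an anticomplete separation one side has no edge, or a [2K_2] appears, and it joins
    the independent set. Across a complete one some side is a clique, or a [C_4] appears, and it
    joins the clique. *)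
Lemma split_partition (G : sgraph) (U : {set G}) :
  P4_free G -> free_2K2 U -> free_C4 U ->
  exists A B, [/\ A :|: B = U, independent A & is_clique B].
Proof.
move=> h4; move: U; apply: (cograph_ind h4)
  => [U U1 _ _|X Y _ _ _ aXY IHX IHY fK fC|X Y cXY IHX IHY fK fC].
- exists U, set0; split; rewrite ?setU0 //.
    by move=> x y xU yU; rewrite ((card_le1_eqP U1) x y) // edge_irrefl.
  by move=> x y; rewrite inE.
- have aYX := anticomplete_sym aXY.
  have iU (V W A : {set G}) :
     anticomplete V W -> independent V -> A \subset W -> independent A ->
     independent (V :|: A).
    move=> aVW iV /subsetP sAW iA x y /setUP[] xV /setUP[] yV.
    - exact: iV.
    - by apply: aVW => //; apply: sAW.
    - by rewrite edge_sym; apply: aVW => //; apply: sAW.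
    - exact: iA.
  case: (independentVedge X) => [iX|[a [b [aX bX ab]]]].
    have [A [B [UE iA cB]]] := IHY (free_2K2_sub (subsetUr _ _) fK)
                                   (free_C4_sub (subsetUr _ _) fC).
    exists (X :|: A), B; split=> //; first by rewrite -UE setUA.
    by apply: iU aXY iX _ iA; rewrite -UE subsetUl.
  case: (independentVedge Y) => [iY|[c [d [cY dY cd]]]].
    have [A [B [UE iA cB]]] := IHX (free_2K2_sub (subsetUl _ _) fK)
                                   (free_C4_sub (subsetUl _ _) fC).
    exists (Y :|: A), B; split=> //; first by rewrite -setUA UE setUC.
    by apply: iU aYX iY _ iA; rewrite -UE subsetUl.
  have /fK/negP[] : {subset [:: a; b; c; d] <= X :|: Y}.
    by apply/subset4P; rewrite !inE aX bX cY dY !orbT.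
  by rewrite /is_2K2 ab cd !aXY.
have cYX := complete_to_sym cXY.
have cU (V W : {set G}) :
    complete_to V W -> is_clique V -> is_clique W -> is_clique (V :|: W).
  move=> cVW cV cW x y /setUP[] xV /setUP[] yV.
  - exact: cV.
  - by rewrite cVW.
  - by rewrite edge_sym cVW.
  - exact: cW.
have [A [B [XE iA cB]]] := IHX (free_2K2_sub (subsetUl _ _) fK)
                               (free_C4_sub (subsetUl _ _) fC).
have [A' [B' [YE iA' cB']]] := IHY (free_2K2_sub (subsetUr _ _) fK)
                                   (free_C4_sub (subsetUr _ _) fC).
have [cX|[a [c [aX cX ac nac]]]] := cliqueVnonedge X.
  exists A', (X :|: B'); split=> //; first by rewrite setUCA YE.
  apply: cU => // x y xX yB'; apply: cXY => //; by rewrite -YE inE yB' orbT.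
have [cY|[b [d [bY dY bd nbd]]]] := cliqueVnonedge Y.
  exists A, (B :|: Y); split=> //; first by rewrite setUA XE.
  apply: cU => // x y xX yB'; apply: cXY => //; by rewrite -XE inE xX orbT.
have /fC/negP[] : {subset [:: a; b; c; d] <= X :|: Y}.
  by apply/subset4P; rewrite !inE aX cX bY dY !orbT.
by rewrite /is_C4 ac bd nac nbd cXY // cYX // cXY // cYX.
Qed.

(** * Forbidden configurations and the construction of polar partitions *)

Definition nonadj (G : sgraph) (s t : seq G) : bool :=
  allrel (fun x y => ~~ edge x y) s t.

Definition no_K1_2K2 (G : sgraph) : Prop :=
  forall x a b c d : G, is_2K2 a b c d -> ~~ nonadj [:: x] [:: a; b; c; d].

Definition no_2K1_C4 (G : sgraph) : Prop :=
  forall x y a b c d : G, is_C4 a b c d -> x != y -> ~~ edge x y ->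
    ~~ nonadj [:: x; y] [:: a; b; c; d].

Definition no_2P3 (G : sgraph) : Prop :=
  forall a b c a' b' c' : G, is_P3 a b c -> is_P3 a' b' c' ->
    ~~ nonadj [:: a; b; c] [:: a'; b'; c'].

(** Here [p], [q], [r] induce the complement of [P_3], with [p] its isolated vertex, and [s], [t]
    form the independent pair joined to it. *)
Definition no_K1_coP3_join_2K1 (G : sgraph) : Prop :=
  forall x p q r s t : G,
    edge q r -> ~~ edge p q -> ~~ edge p r -> s != t -> ~~ edge s t ->
    allrel (@edge G) [:: p; q; r] [:: s; t] ->
    ~~ nonadj [:: x] [:: p; q; r; s; t].

Lemma nonadj_anticomplete (G : sgraph) (X Y : {set G}) (s t : seq G) :
  anticomplete X Y -> {subset s <= X} -> {subset t <= Y} -> nonadj s t.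
Proof. by move=> aXY sX tY; apply/allrelP=> x y /sX xX /tY; apply: aXY. Qed.

(** The outside vertex [x] supplies the isolated vertex that completes each of the two forbidden
    graphs. *)
Lemma multipartite_or_free_C4 (G : sgraph) (x : G) (U : {set G}) :
  P4_free G -> no_2K1_C4 G -> no_K1_coP3_join_2K1 G ->
  x \notin U -> anticomplete [set x] U -> multipartite U \/ free_C4 U.
Proof.
move=> h4 hC hJ; move: U; apply: (cograph_ind h4)
  => [U U1 _ _|X Y X0 Y0 dXY aXY _ _ xU axU|X Y cXY IHX IHY xU axU].
- by left; apply: multipartite_card1.
- right; have aYX := anticomplete_sym aXY.
  (* A four-cycle in [V], the vertex [x] and any vertex of [W] induce [2K_1 + C_4]. *)
  have fC (V W : {set G}) : V :|: W = X :|: Y -> W != set0 -> anticomplete V W ->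
      free_C4 V.
    move=> UE /set0Pn[y yW] aVW a b c d aV; apply/negP=> C4.
    have sV (z : G) : z \in V -> z \in X :|: Y by rewrite -UE inE => ->.
    have sW (z : G) : z \in W -> z \in X :|: Y by rewrite -UE inE orbC => ->.
    have xy : x != y by apply: contraNneq xU => ->; apply: sW.
    have nxy : ~~ edge x y by apply: axU; rewrite ?set11 ?sW.
    have /negP[] := hC x y a b c d C4 xy nxy.
    apply/allrelP=> u v hu /aV vV; move: hu; rewrite !inE => /orP[] /eqP->.
      by apply: axU; rewrite ?set11 ?sV.
    by rewrite edge_sym aVW.
  apply: free_C4_anticomplete => //; first exact: fC aXY.
  by apply: fC aYX; rewrite 1?setUC.
have cYX := complete_to_sym cXY.
(* The triple [p], [q], [r] excludes the multipartite alternative for [V] and forces [W] to be a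
   clique. Each vertex of a four-cycle has a non-neighbour on it, so the cycle would lie inside
   [V]. *)
have fC (V W : {set G}) p q r :
    V :|: W = X :|: Y -> complete_to V W -> multipartite V \/ free_C4 V ->
    p \in V -> q \in V -> r \in V -> edge q r -> ~~ edge p q -> ~~ edge p r ->
    free_C4 (X :|: Y).
  move=> UE cVW IH pV qV rV qr pq pr.
  have {IH} fV : free_C4 V.
    case: IH => // mV; have := mV p q r pV qV rV qr.
    by rewrite (negPf pq) (negPf pr).
  have cW : is_clique W.
    case: (cliqueVnonedge W) => // -[s [t [sW tW st nst]]].
    have /negP[] : ~~ nonadj [:: x] [:: p; q; r; s; t].
      apply: hJ => //; apply/allrelP=> u v; rewrite !inE => hu hv; apply: cVW.
        by case/or3P: hu => /eqP->.
      by case/orP: hv => /eqP->.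
    apply: (nonadj_anticomplete axU) => z; rewrite -?UE !inE //.
    by case/or3P=> [| |/or3P[]] /eqP->; apply/orP; by [left | right].
  move=> a b c d; rewrite -UE => hU; apply/negP=> C4; move: (C4).
  case/and5P=> ac bd _ _ /and4P[_ _ nac nbd].
  have [aU bU cU dU] := (subset4P _ _ _ _ _).1 hU.
  have in_V u v : u \in V :|: W -> v \in V :|: W -> u != v -> ~~ edge u v ->
      u \in V /\ v \in V.
    move=> uU vU uv nuv; case: (nonedge_complete_to cVW uU vU nuv) => // -[uW vW].
    by rewrite cW in nuv.
  have [aV cV] := in_V _ _ aU cU ac nac; have [bV dV] := in_V _ _ bU dU bd nbd.
  by have /subset4P/fV/negP[] := And4 aV bV cV dV.
have [|[p [q [r [[pU qU rU] [qr pq pr]]]]]] := multipartiteVcoP3 (X :|: Y).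
  by left.
right.
have [xX axX] : x \notin X /\ anticomplete [set x] X.
  split=> [|y z xy zX]; first by apply: contra xU => xX; rewrite inE xX.
  by apply: axU => //; rewrite inE zX.
have [xY axY] : x \notin Y /\ anticomplete [set x] Y.
  split=> [|y z xy zY]; first by apply: contra xU => xY; rewrite inE xY orbT.
  by apply: axU => //; rewrite inE zY orbT.
(* Since [p] is adjacent to neither [q] nor [r], all three lie on the same side. *)
have [[pX qX]|[pY qY]] := nonedge_complete_to cXY pU qU pq.
  have rX : r \in X by case/setUP: rU => // rY; rewrite cXY in pr.
  exact: (fC X Y p q r erefl cXY (IHX xX axX)).
have rY : r \in Y by case/setUP: rU => // rX; rewrite cYX in pr.
exact: (fC Y X p q r (setUC _ _) cYX (IHY xY axY)).
Qed.

(** [A] and [B] may overlap; the theorem finally replaces [B] by the complement of [A]. *)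
Definition polar (G : sgraph) (U : {set G}) : Prop :=
  exists A B, [/\ A :|: B = U, multipartite A & is_clique B].

Lemma polar_independent_anticomplete (G : sgraph) (X Y : {set G}) :
  P4_free G -> no_K1_2K2 G -> no_2K1_C4 G -> no_K1_coP3_join_2K1 G ->
  X != set0 -> [disjoint X & Y] -> anticomplete X Y -> independent X ->
  polar (X :|: Y).
Proof.
move=> h4 hK hC hJ /set0Pn[x xX] dXY aXY iX.
have axU (z y : G) : z \in X -> y \in X :|: Y -> ~~ edge z y.
  by move=> zX /setUP[]; [apply: iX | apply: aXY].
(* The vertex [x] is isolated in [X :|: Y], so it would extend a [2K_2] to [K_1 + 2K_2]. *)
have fK : free_2K2 (X :|: Y).
  move=> a b c d sU; apply/negP=> /(hK x)/negP[].
  by apply/allrelP=> u v /predU1P[->|//] /sU; apply: axU.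
have fX : free_C4 X.
  move=> a b c d /subset4P[aX bX _ _]; apply/negP=> /and5P[_ _ ab _ _].
  by rewrite (negPf (iX _ _ aX bX)) in ab.
have [fY|[a [b [c [d [sY C4]]]]]] := free_C4VC4 Y.
  have [A [B [UE iA cB]]] := split_partition h4 fK (free_C4_anticomplete aXY fX fY).
  by exists A, B; split=> //; apply: independent_multipartite.
have xY : x \notin Y by rewrite (disjointFr dXY xX).
have axY : anticomplete [set x] Y by move=> u v /set1P->; apply: aXY.
have [mY|fY] := multipartite_or_free_C4 h4 hC hJ xY axY; last first.
  by case/negP: (fY _ _ _ _ sY).
(* Two distinct vertices of [X] would form [2K_1 + C_4] with the cycle in [Y], so [X] is a single
   vertex and serves as the clique. *)
exists Y, X; split=> //; first by rewrite setUC.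
move=> u v uX vX uv; case/negP: (hC u v a b c d C4 uv (iX u v uX vX)).
apply: (nonadj_anticomplete aXY) => // z.
by rewrite !inE => /orP[] /eqP->.
Qed.

Lemma polar_of_forbidden (G : sgraph) (U : {set G}) :
  P4_free G -> no_K1_2K2 G -> no_2K1_C4 G -> no_2P3 G ->
  no_K1_coP3_join_2K1 G -> polar U.
Proof.
move=> h4 hK hC hP hJ; move: U; apply: (cograph_ind h4)
  => [U U1|X Y X0 Y0 dXY aXY _ _|X Y cXY [A [B [XE mA cB]]] [A' [B' [YE mA' cB']]]].
- exists U, set0; split; rewrite ?setU0 //; first exact: multipartite_card1.
  by move=> x y; rewrite inE.
- have aYX := anticomplete_sym aXY.
  have [iX|[p [q [pX qX pq]]]] := independentVedge X.
    exact: polar_independent_anticomplete.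
  have [iY|[r [s [rY sY rs]]]] := independentVedge Y.
    by rewrite setUC; apply: polar_independent_anticomplete; rewrite 1?disjoint_sym.
  (* An induced [K_1 + K_2] in [V] and an edge of [W] would form [K_1 + 2K_2]. *)
  have mult (V W : {set G}) u v : anticomplete V W -> u \in W -> v \in W ->
      edge u v -> multipartite V.
    move=> aVW uW vW uv.
    have [//|[x [y [z [[xV yV zV] [yz nxy nxz]]]]]] := multipartiteVcoP3 V.
    have /(hK x)/negP[] : is_2K2 y z u v by rewrite /is_2K2 yz uv !aVW.
    by rewrite /nonadj /allrel /= nxy nxz !aVW.
  have mX : multipartite X by apply: mult aXY rY sY rs.
  have mY : multipartite Y by apply: mult aYX pX qX pq.
  have [cX|[a [b [c [[aX bX cX] abc]]]]] := multipartite_clique_or_P3 pX qX pq mX.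
    by exists Y, X; split=> //; rewrite setUC.
  have [cY|[a' [b' [c' [[aY bY cY] abc']]]]] := multipartite_clique_or_P3 rY sY rs mY.
    by exists X, Y.
  case/negP: (hP a b c a' b' c' abc abc').
  by apply: (nonadj_anticomplete aXY) => z; rewrite !inE => /or3P[] /eqP->.
subst X Y; exists (A :|: A'), (B :|: B'); split; first by rewrite setUACA.
  have cAA x y : x \in A -> y \in A' -> edge x y.
    by move=> xA yA; apply: cXY; apply/setUP; left.
  have cAA' x y : x \in A' -> y \in A -> edge x y.
    by move=> xA yA; rewrite edge_sym cAA.
  move=> x y z /setUP[xA|xA] /setUP[yA|yA] /setUP[zA|zA] yz;
    first [ exact: mA | exact: mA' | by rewrite cAA | by rewrite orbC cAA
          | by rewrite cAA' | by rewrite orbC cAA' ].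
move=> x y /setUP[] xB /setUP[] yB xy; [exact: cB | | | exact: cB'].
  by apply: cXY; apply/setUP; right.
by rewrite edge_sym; apply: cXY; apply/setUP; right.
Qed.

(** * Polarity is hereditary and fails for the four forbidden graphs *)

Lemma polar_induced (H G : sgraph) :
  induced_subgraph H G -> polar [set: G] -> polar [set: H].
Proof.
case=> f [inj_f hf] [A [B [UE mA cB]]]; exists (f @^-1: A), (f @^-1: B); split.
- by rewrite -preimsetU UE preimsetT.
- by move=> x y z; rewrite !inE => xA yA zA; rewrite -!hf; apply: mA.
- by move=> x y; rewrite !inE => xB yB xy; rewrite -hf; apply: cB; rewrite ?(inj_eq inj_f).
Qed.

(** With [B] eliminated, polarity becomes a family of boolean clauses on membership in [A]. On each
    forbidden graph finitely many instances are contradictory, which a truth table checks. *)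
Lemma polar_setT (G : sgraph) :
  polar [set: G] -> exists A : {set G},
    (forall x y z, edge y z -> ~~ edge x y -> ~~ edge x z ->
       ~~ [&& x \in A, y \in A & z \in A]) /\
    (forall x y, x != y -> ~~ edge x y -> (x \in A) || (y \in A)).
Proof.
case=> A [B [UE mA cB]]; exists A; split=> [x y z yz xy xz|x y xy].
  apply/negP=> /and3P[xA yA zA]; have := mA x y z xA yA zA yz.
  by rewrite (negPf xy) (negPf xz).
have inB z : (z \in A) || (z \in B) by rewrite -in_setU UE inE.
move: (inB x) (inB y); case: (x \in A) => //=; case: (y \in A) => //= xB yB.
by rewrite cB.
Qed.

(** A clique lies in one component, so deleting it leaves an edge and a vertex of another
    component. *)
Lemma K1_2K2_not_polar :
  ~ polar [set: disjoint_union (complete_graph 1) (copies 2 (complete_graph 2))].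
Proof.
case/polar_setT=> A [m n].
pose i0 : 'I_2 := @Ordinal 2 0 isT; pose i1 : 'I_2 := @Ordinal 2 1 isT.
pose H := disjoint_union (complete_graph 1) (copies 2 (complete_graph 2)).
pose x : H := inl ord0.
pose a : H := inr (i0, i0); pose b : H := inr (i0, i1).
pose c : H := inr (i1, i0); pose d : H := inr (i1, i1).
move: (m x a b isT isT isT) (m x c d isT isT isT) (m a c d isT isT isT).
move: (n x a isT isT) (n x b isT isT) (n x c isT isT) (n x d isT isT).
move: (n a c isT isT) (n a d isT isT) (n b c isT isT) (n b d isT isT).
by case: (x \in A) (a \in A) (b \in A) (c \in A) (d \in A) => [] [] [] [] [].
Qed.

(** Deleting a clique leaves an edge of the cycle and one of the isolated vertices. *)
Lemma C4_2K1_not_polar :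
  ~ polar [set: disjoint_union (compl_graph (complete_graph 2)) (cycle_graph 4)].
Proof.
case/polar_setT=> A [m n].
pose H := disjoint_union (compl_graph (complete_graph 2)) (cycle_graph 4).
pose x : H := inl (@Ordinal 2 0 isT); pose y : H := inl (@Ordinal 2 1 isT).
pose a : H := inr (@Ordinal 4 0 isT); pose b : H := inr (@Ordinal 4 1 isT).
pose c : H := inr (@Ordinal 4 2 isT); pose d : H := inr (@Ordinal 4 3 isT).
move: (n x y isT isT) (n a c isT isT) (n b d isT isT).
move: (m x a b isT isT isT) (m x b c isT isT isT).
move: (m x c d isT isT isT) (m x a d isT isT isT).
move: (m y a b isT isT isT) (m y b c isT isT isT).
move: (m y c d isT isT isT) (m y a d isT isT isT).
by case: (x \in A) (y \in A) (a \in A) (b \in A) (c \in A) (d \in A)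
  => [] [] [] [] [] [].
Qed.

(** A clique misses one path entirely and at least one vertex of the other. *)
Lemma P3_P3_not_polar : ~ polar [set: copies 2 (path_graph 3)].
Proof.
case/polar_setT=> A [m n].
pose i0 : 'I_2 := @Ordinal 2 0 isT; pose i1 : 'I_2 := @Ordinal 2 1 isT.
pose j0 : 'I_3 := @Ordinal 3 0 isT; pose j1 : 'I_3 := @Ordinal 3 1 isT.
pose j2 : 'I_3 := @Ordinal 3 2 isT.
pose H := copies 2 (path_graph 3).
pose a : H := (i0, j0); pose b : H := (i0, j1); pose c : H := (i0, j2).
pose a' : H := (i1, j0); pose b' : H := (i1, j1); pose c' : H := (i1, j2).
move: (n a c isT isT) (n a' c' isT isT).
move: (n a a' isT isT) (n a b' isT isT) (n a c' isT isT).
move: (n b a' isT isT) (n b b' isT isT) (n b c' isT isT).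
move: (n c a' isT isT) (n c b' isT isT) (n c c' isT isT).
move: (m a' a b isT isT isT) (m c' a b isT isT isT).
move: (m a a' b' isT isT isT) (m c a' b' isT isT isT).
by case: (a \in A) (b \in A) (c \in A) (a' \in A) (b' \in A) (c' \in A)
  => [] [] [] [] [] [].
Qed.

(** Deleting [x] leaves [p], [q], [r]. A clique avoiding [x] misses one of [s], [t] and one of [p],
    [q], [r], which leaves an edge beside [x]. *)
Lemma K1_coP3_join_2K1_not_polar :
  ~ polar [set: disjoint_union (complete_graph 1)
                  (join_graph (compl_graph (path_graph 3))
                              (compl_graph (complete_graph 2)))].
Proof.
case/polar_setT=> A [m n].
pose H := disjoint_union (complete_graph 1)
  (join_graph (compl_graph (path_graph 3)) (compl_graph (complete_graph 2))).
pose x : H := inl ord0.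
(* The middle vertex of the path is isolated in its complement, hence the order [q], [p], [r]. *)
pose q : H := inr (inl (@Ordinal 3 0 isT)); pose p : H := inr (inl (@Ordinal 3 1 isT)).
pose r : H := inr (inl (@Ordinal 3 2 isT)).
pose s : H := inr (inr (@Ordinal 2 0 isT)); pose t : H := inr (inr (@Ordinal 2 1 isT)).
move: (n x p isT isT) (n x q isT isT) (n x r isT isT) (n p q isT isT) (n s t isT isT).
move: (m p q r isT isT isT) (m x p s isT isT isT) (m x p t isT isT isT).
move: (m x q s isT isT isT) (m x q t isT isT isT).
by case: (x \in A) (p \in A) (q \in A) (r \in A) (s \in A) (t \in A)
  => [] [] [] [] [] [].
Qed.

(** * From vertex configurations to induced subgraphs *)

Ltac edge_contra :=
  match goal with
  | H : is_true (edge ?x ?x) |- _ => by rewrite edge_irrefl in H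
  | H : is_true (?x != ?x) |- _ => by rewrite eqxx in H
  | H : is_true (edge ?x ?y), H' : is_true (~~ edge ?x ?y) |- _ =>
      by rewrite H in H'
  | H : is_true (edge ?x ?y), H' : is_true (~~ edge ?y ?x) |- _ =>
      by rewrite edge_sym H in H'
  end.

Ltac edge_eval :=
  match goal with
  | |- edge ?x ?x = _ => rewrite edge_irrefl
  | H : is_true (edge ?x ?y) |- edge ?x ?y = _ => rewrite H
  | H : is_true (edge ?x ?y) |- edge ?y ?x = _ => rewrite edge_sym H
  | H : is_true (~~ edge ?x ?y) |- edge ?x ?y = _ => rewrite (negPf H)
  | H : is_true (~~ edge ?x ?y) |- edge ?y ?x = _ => rewrite edge_sym (negPf H)
  end.

(** Injectivity of the embedding comes from the adjacencies: identifying two of the vertices would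
    make some pair both an edge and a non-edge, or give a loop. *)
Lemma cograph_P4_free (G : sgraph) : cograph G -> P4_free G.
Proof.
move=> hG a b c d ab bc cd ac ad bd; apply: hG.
exists (fun i : 'I_4 => nth a [:: a; b; c; d] i); split.
  case=> [[|[|[|[|//]]]] ?] [[|[|[|[|//]]]] ?] /= E;
    first [by apply/eqP | subst; edge_contra].
by case=> [[|[|[|[|//]]]] ?] [[|[|[|[|//]]]] ?] /=; edge_eval.
Qed.

Lemma no_K1_2K2P (G : sgraph) :
  ~ induced_subgraph
      (disjoint_union (complete_graph 1) (copies 2 (complete_graph 2))) G ->
  no_K1_2K2 G.
Proof.
move=> hG x a b c d /and5P[ab cd ac ad /andP[bc bd]].
apply/negP; rewrite /nonadj /allrel /= !andbT => /and4P[xa xb xc xd].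
apply: hG.
(* The defaults of [nth] are never reached, because the indices are bounded ordinals. *)
exists (fun v : 'I_1 + 'I_2 * 'I_2 => match v with
  | inl _ => x
  | inr u => nth x (nth [::] [:: [:: a; b]; [:: c; d]] u.1) u.2
  end); split.
  case=> [[[|//] ?]|[[[|[|//]] ?] [[|[|//]] ?]]]
         [[[|//] ?]|[[[|[|//]] ?] [[|[|//]] ?]]] /= E;
    first [by apply/eqP | subst; edge_contra].
by case=> [[[|//] ?]|[[[|[|//]] ?] [[|[|//]] ?]]]
          [[[|//] ?]|[[[|[|//]] ?] [[|[|//]] ?]]]; rewrite [LHS]/=; edge_eval.
Qed.

Lemma no_2K1_C4P (G : sgraph) :
  ~ induced_subgraph
      (disjoint_union (compl_graph (complete_graph 2)) (cycle_graph 4)) G ->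
  no_2K1_C4 G.
Proof.
move=> hG x y a b c d /and5P[ac bd ab bc /and4P[cd da nac nbd]] xy nxy.
apply/negP; rewrite /nonadj /allrel /= !andbT.
move=> /andP[/and4P[xa xb xc xd] /and4P[ya yb yc yd]]; apply: hG.
exists (fun v : 'I_2 + 'I_4 => match v with
  | inl u => nth x [:: x; y] u
  | inr u => nth x [:: a; b; c; d] u
  end); split.
  case=> [[[|[|//]] ?]|[[|[|[|[|//]]]] ?]]
         [[[|[|//]] ?]|[[|[|[|[|//]]]] ?]] /= E;
    first [by apply/eqP | subst; edge_contra].
by case=> [[[|[|//]] ?]|[[|[|[|[|//]]]] ?]]
          [[[|[|//]] ?]|[[|[|[|[|//]]]] ?]]; rewrite [LHS]/=; edge_eval.
Qed.

Lemma no_2P3P (G : sgraph) :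
  ~ induced_subgraph (copies 2 (path_graph 3)) G -> no_2P3 G.
Proof.
move=> hG a b c a' b' c' /and4P[ac ab bc nac] /and4P[ac' ab' bc' nac'].
apply/negP; rewrite /nonadj /allrel /= !andbT.
move=> /and3P[/and3P[aa' ? ?] /and3P[? ? ?] /and3P[? ? ?]]; apply: hG.
exists (fun u : 'I_2 * 'I_3 => nth a (nth [::] [:: [:: a; b; c]; [:: a'; b'; c']] u.1) u.2).
split.
  case=> [[[|[|//]] ?] [[|[|[|//]]] ?]] [[[|[|//]] ?] [[|[|[|//]]] ?]] /= E;
    first [by apply/eqP | subst; edge_contra].
by case=> [[[|[|//]] ?] [[|[|[|//]]] ?]] [[[|[|//]] ?] [[|[|[|//]]] ?]];
  rewrite [LHS]/=; edge_eval.
Qed.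

Lemma no_K1_coP3_join_2K1P (G : sgraph) :
  ~ induced_subgraph
      (disjoint_union (complete_graph 1)
         (join_graph (compl_graph (path_graph 3))
                     (compl_graph (complete_graph 2)))) G ->
  no_K1_coP3_join_2K1 G.
Proof.
move=> hG x p q r s t qr pq pr st nst.
rewrite /nonadj /allrel /= !andbT.
move=> /and3P[/andP[? ?] /andP[? ?] /andP[? ?]].
apply/negP=> /and5P[? ? ? ? ?]; apply: hG.
exists (fun v : 'I_1 + ('I_3 + 'I_2) => match v with
  | inl _ => x
  | inr (inl u) => nth x [:: q; p; r] u
  | inr (inr u) => nth x [:: s; t] u
  end); split.
  case=> [[[|//] ?]|[[[|[|[|//]]] ?]|[[|[|//]] ?]]]
         [[[|//] ?]|[[[|[|[|//]]] ?]|[[|[|//]] ?]]] /= E;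
    first [by apply/eqP | subst; edge_contra].
by case=> [[[|//] ?]|[[[|[|[|//]]] ?]|[[|[|//]] ?]]]
          [[[|//] ?]|[[[|[|[|//]]] ?]|[[|[|//]] ?]]]; rewrite [LHS]/=; edge_eval.
Qed.

(** * Complete multipartite sets through partitions, and the theorem *)

Lemma complete_multipartite_multipartite (G : sgraph) (s : nat) (A : {set G}) :
  induces_complete_multipartite s A -> multipartite A.
Proof.
case=> P [/and3P[_ /trivIsetP tP _] _ hP] x y z xA yA zA.
rewrite !hP // -negb_and; apply: contra.
case/andP=> /exists_inP[p pP /andP[xp yp]] /exists_inP[q qP /andP[xq zq]].
apply/exists_inP; exists p => //; rewrite yp.
(* The blocks [p] and [q] share [x], so they coincide, and [y], [z] lie in one block. *)
have [-> //|npq] := eqVneq p q.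
by have /disjoint_setI0/setP/(_ x) := tP p q pP qP npq; rewrite !inE xp xq.
Qed.

(** Non-adjacency is an equivalence relation on [A]: reflexive because there are no loops,
    transitive by [multipartite]. Its classes are the parts. *)
Lemma multipartite_complete_multipartite (G : sgraph) (A : {set G}) :
  multipartite A -> exists s, induces_complete_multipartite s A.
Proof.
move=> mA; pose R := fun x y : G => ~~ edge x y.
have eR : {in A & &, equivalence_rel R}.
  move=> x y z xA yA zA; rewrite /R edge_irrefl; split=> // xy.
  apply/idP/idP; apply: contra => h.
    by have := mA x y z xA yA zA h; rewrite (negPf xy).
  by have := mA y x z yA xA zA h; rewrite edge_sym (negPf xy).
have pA := equivalence_partitionP eR.
exists #|equivalence_partition R A|, (equivalence_partition R A); split=> //.
case/and3P: (pA) => /eqP cP tP _ x y xA yA; apply/idP/negP; last first.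
  move=> nP; apply/negPn/negP=> xy; apply: nP; apply/exists_inP.
  exists (pblock (equivalence_partition R A) x).
    by apply: pblock_mem; rewrite cP.
  by rewrite mem_pblock cP xA (pblock_equivalence_partition eR).
move=> xy /exists_inP[p pP /andP[xp yp]].
have := pblock_equivalence_partition eR xA yA.
by rewrite (def_pblock tP pP xp) yp /R xy.
Qed.

Lemma complete_multipartite_leq (G : sgraph) (s t : nat) (A : {set G}) :
  s <= t -> induces_complete_multipartite s A ->
  induces_complete_multipartite t A.
Proof. by move=> st [P [pP Ps hP]]; exists P; split=> //; apply: leq_trans st. Qed.

Theorem theorem12 (G : sgraph) (hG : cograph G) :
  (exists s : nat, 2 <= s /\ exists A B : {set G}, polar_partition s A B) <->
  [/\ ~ induced_subgraph
          (disjoint_union (complete_graph 1) (copies 2 (complete_graph 2))) G,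
      ~ induced_subgraph
          (disjoint_union (compl_graph (complete_graph 2)) (cycle_graph 4)) G,
      ~ induced_subgraph (copies 2 (path_graph 3)) G &
      ~ induced_subgraph
          (disjoint_union (complete_graph 1)
             (join_graph (compl_graph (path_graph 3))
                         (compl_graph (complete_graph 2)))) G].
Proof.
split=> [[s [_ [A [B [UE _ mA cB]]]]]|[/no_K1_2K2P hK /no_2K1_C4P hC]].
  have pG : polar [set: G].
    by exists A, B; split=> //; apply: complete_multipartite_multipartite mA.
  split=> /polar_induced/(_ pG).
  - exact: K1_2K2_not_polar.
  - exact: C4_2K1_not_polar.
  - exact: P3_P3_not_polar.
  - exact: K1_coP3_join_2K1_not_polar.
move=> /no_2P3P hP /no_K1_coP3_join_2K1P hJ.
have [A [B [UE mA cB]]] :=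
  polar_of_forbidden [set: G] (cograph_P4_free hG) hK hC hP hJ.
have [s hs] := multipartite_complete_multipartite mA.
(* There may be fewer than two classes, hence the maximum with 2. *)
exists (maxn 2 s); split; first exact: leq_maxl.
exists A, (~: A); split; [exact: setUCr | exact: setICr | |].
  exact: complete_multipartite_leq (leq_maxr _ _) hs.
have nAB z : z \notin A -> z \in B.
  have /setUP[->|//] : z \in A :|: B by rewrite UE inE.
  by [].
by move=> x y; rewrite !inE => /nAB xB /nAB yB; apply: cB.
Qed.
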